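(* Let $\widetilde V=\sum_{j=1}^J\widetilde V_j$ be a subspace decomposition, and assume that there are constants $C_{\rm st}>0$ and $C_{\rm reg}>0$ such that: (A1) for every $v\in\widetilde V\cap V^\perp$ there exist $v_j\in\widetilde V_j$ $(1\le j\le J)$ with $v=\sum_{j=1}^Jv_j$ and $\sum_{j=1}^J\|v_j\|_a^2\le C_{\rm st}\|v\|_a^2$; (A2) for every $v\in\widetilde V$ and all $v_j\in\widetilde V_j$ with $v=\sum_{j=1}^Jv_j$, one has $\|v\|_a^2\le C_{\rm reg}\sum_{j=1}^J\|v_j\|_a^2$. Let $\omega\in(0,C_{\rm reg}^{-1}]$, let $m\ge1$ be an integer, and let $R_mu_h$ be the output of the $m$-step smoothing iteration with initial guess $u_h$ and smoother $S=\omega S_{\rm add}$ or $S=\bar S_{\rm mult}$. Then $$\|u-R_mu_h\|_a\le 2\|u-\tilde u_h\|_a+\varepsilon_m(\delta)\,\|u-u_h\|_a,$$ where $\delta=C_{\rm st}/\omega$ if $S=\omega S_{\rm add}$, $\delta=C_{\rm st}M^2$ if $S=\bar S_{\rm mult}$, and $$\varepsilon_m(\delta)=\begin{cases}\left(\dfrac{\delta-1}{\delta}\right)^m, & m\le(\delta-1)/2,\\[2mm] \delta^{1/2}\,\dfrac{m^m(1/2)^{1/2}}{(m+1/2)^{m+1/2}}, & m>(\delta-1)/2.\end{cases}$$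
   Context: $V\subset\widetilde V$ are finite-dimensional real vector spaces (finite element spaces), and $a:\widetilde V\times\widetilde V\to\mathbb R$ is a symmetric, coercive (positive-definite) bilinear form with energy norm $\|v\|_a=\sqrt{a(v,v)}$. $V^\perp$ is the orthogonal complement of $V$ in $\widetilde V$ with respect to $a(\cdot,\cdot)$. $\widetilde V'$ is the dual of $\widetilde V$ and $\langle\cdot,\cdot\rangle$ the duality pairing. The operator $A:\widetilde V\to\widetilde V'$ is defined by $\langle Av,w\rangle=a(v,w)$. Given $f\in V'$ and $\tilde f\in\widetilde V'$ with $\tilde f|_V=f$, $u_h\in V$ solves $a(u_h,v)=f(v)$ for all $v\in V$, and $\tilde u_h\in\widetilde V$ solves $a(\tilde u_h,v)=\tilde f(v)$ for all $v\in\widetilde V$. The element $u$ is the exact solution being approximated; it may lie outside $\widetilde V$, and $\|\cdot\|_a$ is understood to extend to a seminorm on $\widetilde V+\mathrm{span}\{u\}$ that agrees with the energy norm on $\widetilde V$. $m$-step smoothing iteration with smoother $S:\widetilde V'\to\widetilde V$: set $u_0=u_h$, $u_k=u_{k-1}+S(\tilde f-Au_{k-1})$ for $k=1,\dots,m$, and $R_mu_h=u_m$. The subspaces $\widetilde V_j\subset\widetilde V$ need not form a direct sum. Additive smoother: for $r\in\widetilde V'$, let $e_j\in\widetilde V_j$ solve $a(e_j,v_j)=r(v_j)$ for all $v_j\in\widetilde V_j$, $1\le j\le J$; then $S_{\rm add}r=\sum_{j=1}^Je_j$. Multiplicative smoother: set $e_0=0$; for $j=1,\dots,J$ let $\eta_j\in\widetilde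 V_j$ solve $a(\eta_j,v_j)=r(v_j)-a(e_{j-1},v_j)$ for all $v_j\in\widetilde V_j$ and set $e_j=e_{j-1}+\eta_j$; then $S_{\rm mult}r=e_J$. $S_{\rm mult}^t$ is the same procedure with the subspaces visited in the reverse order $j=J,\dots,1$. The symmetrized multiplicative smoother is $\bar S_{\rm mult}=S_{\rm mult}+S_{\rm mult}^t-S_{\rm mult}^tAS_{\rm mult}$. $P_j:\widetilde V\to\widetilde V_j$ is the $a(\cdot,\cdot)$-orthogonal projection, and $M=\max_{1\le j\le J}\#\{1\le i\le J: P_i\widetilde V_j\ne\{0\}\}$. *)

(* Defs.v *)
From HB Require Import structures.
From mathcomp Require Import all_boot all_order all_algebra.
From mathcomp Require Import all_classical all_reals all_analysis.

Set Implicit Arguments.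
Unset Strict Implicit.
Unset Printing Implicit Defensive.

Import Order.TTheory GRing.Theory Num.Theory.
Local Open Scope ring_scope.

Section Energy.
Variables (R : realType) (Vt : vectType R).
(* a symmetric positive-definite bilinear form; on a finite-dimensional space
   positive definiteness is the same as coercivity *)
Variable a : {dot Vt for (idfun : R -> R)}.
Implicit Types (U : {vspace Vt}) (r : 'Hom(Vt, R^o)).

Definition energy_norm (v : Vt) : R := Num.sqrt (a v v).

Definition energy_op (v : Vt) : 'Hom(Vt, R^o) := linfun (a v : Vt -> R^o).

(* Existence and uniqueness of the element described here are subsolveP and
   subsolve_unique below, so the default value 0 is never used. *)
Definition subsolve U r : Vt :=
  xget 0 [set e : Vt | e \in U /\ {in U, forall v, a e v = r v}]%classic.

Definition energy_proj U (v : Vt) : Vt := subsolve U (energy_op v).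

Lemma energy_opE v w : energy_op v w = a v w.
Proof. by rewrite /energy_op lfunE. Qed.

Lemma subsolve_exists U r :
  exists e : Vt, e \in U /\ {in U, forall v, a e v = r v}.
Proof.
pose L := linfun (fun e : subvs_of U =>
  \row_(i < \dim U) a (vsval e) (vbasis U)`_i).
have Llin : linear (fun e : subvs_of U =>
    \row_(i < \dim U) a (vsval e) (vbasis U)`_i).
  move=> c x y; apply/rowP => i.
  by rewrite !mxE linearPl /=.
pose Lm := GRing.isLinear.Build _ _ _ _ _ Llin.
pose L' : {linear _ -> _} := HB.pack (fun e : subvs_of U =>
    \row_(i < \dim U) a (vsval e) (vbasis U)`_i) Lm.
have LE e i : L e 0 i = a (vsval e) (vbasis U)`_i.
  by rewrite /L (lfunE L') /= mxE.
have ext (e : Vt) : (forall i : 'I_(\dim U), a e (vbasis U)`_i = r (vbasis U)`_i) ->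
    {in U, forall v, a e v = r v}.
  move=> h v vU; rewrite (coord_vbasis vU) !linear_sum /=.
  by apply: eq_bigr => i _; rewrite linearZr linearZ /= h.
have Lker : lker L == 0%VS.
  apply/lker0P => x y Lxy; apply: val_inj => /=; apply/eqP.
  rewrite -subr_eq0; apply/negPn/negP => nz.
  have := @neq0_dnorm_gt0 _ _ _ a _ nz.
  have dU : vsval x - vsval y \in U by rewrite memvB ?subvsP.
  rewrite {2}(coord_vbasis dU) linear_sumr /= big1 ?ltxx// => i _.
  by rewrite linearZr /= linearBl /= -!LE Lxy subrr mulr0.
have Lfull : (limg L = fullv)%VS.
  apply/eqP; rewrite eqEdim subvf (limg_dim_eq); last by rewrite (eqP Lker) capv0.
  by rewrite !dimvf /dim /= mul1n.
have : (\row_(i < \dim U) (r (vbasis U)`_i : R)) \in limg L by rewrite Lfull memvf.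
case/memv_imgP => e _ eE; exists (vsval e); split; first exact: subvsP.
by apply: ext => i; rewrite -LE -eE mxE.
Qed.

Lemma subsolveP U r :
  subsolve U r \in U /\ {in U, forall v, a (subsolve U r) v = r v}.
Proof.
rewrite /subsolve; case: xgetP => [_ _ //|].
by case: (subsolve_exists U r) => e he /(_ e).
Qed.

Lemma subsolve_unique U r e :
  e \in U -> {in U, forall v, a e v = r v} -> e = subsolve U r.
Proof.
have [sU sE] := subsolveP U r => eU eE; apply/eqP; rewrite -subr_eq0.
apply/negPn/negP => /(@neq0_dnorm_gt0 _ _ _ a).
have dU : e - subsolve U r \in U by rewrite memvB.
by rewrite linearBl /= eE // sE // subrr ltxx.
Qed.

Section Smoothers.
Variables (J : nat) (W : 'I_J -> {vspace Vt}).

Definition S_add r : Vt := \sum_(j < J) subsolve (W j) r.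

(* the residual r - energy_op e is the functional v |-> r v - a e v *)
Definition mult_sweep (s : seq 'I_J) r : Vt :=
  foldl (fun e j => e + subsolve (W j) (r - energy_op e)) 0 s.

Definition S_mult r : Vt := mult_sweep (enum 'I_J) r.

Definition S_mult_t r : Vt := mult_sweep (rev (enum 'I_J)) r.

Definition S_mult_sym r : Vt :=
  S_mult r + S_mult_t r - S_mult_t (energy_op (S_mult r)).

Definition max_interactions : nat :=
  \max_(j < J) #|[pred i : 'I_J |
    `[< (energy_proj (W i) @` [set v | v \in W j] <> [set 0%R])%classic >]]|.

End Smoothers.

Definition smoothing_iter (S : 'Hom(Vt, R^o) -> Vt) (ft : 'Hom(Vt, R^o))
    (m : nat) (u0 : Vt) : Vt :=
  iter m (fun w => w + S (ft - energy_op w)) u0.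

End Energy.

(* N is a seminorm on the subspace D; nonnegativity follows from these axioms *)
Definition seminorm_on (R : realType) (E : lmodType R) (D : set E)
    (N : E -> R) : Prop :=
  (forall x y, D x -> D y -> N (x + y) <= N x + N y) /\
  (forall (c : R) x, D x -> N (c *: x) = `|c| * N x).

Definition smoothing_rate (R : realType) (m : nat) (delta : R) : R :=
  if m%:R <= (delta - 1) / 2 then ((delta - 1) / delta) ^+ m
  else delta `^ (1 / 2) *
       (m%:R ^+ m * (1 / 2) `^ (1 / 2) / (m%:R + 1 / 2) `^ (m%:R + 1 / 2)).

(* Main.v *)
Require Import Defs.
From HB Require Import structures.
From mathcomp Require Import all_boot all_order all_algebra.
From mathcomp Require Import all_classical all_reals all_analysis.
From mathcomp Require Import ring lra.

(** Write [e = ut - uh], which is [a]-orthogonal to [V], and let [B] be the error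
propagation operator of one smoothing step, [S A = 1 - B].  After [m] steps the
error [ut - u_m] is [B^m e].  For both smoothers [B] is [a]-symmetric with
[0 <= B <= 1], and the triangle inequality for the seminorm reduces the theorem
to [|B^m e| <= eps_m |e|] together with [0 <= eps_m <= 1] (the second summand
[|u - ut|] comes from [|e| <= |u - uh| + |u - ut|]).

The contraction estimate combines two facts.

- Approximation.  A stable splitting of [e] over the subspaces, together with
  [sum_j |P_j w|^2 <= K a((1 - B) w, w)] for all [w], gives
  [a((1 - B)^-1 e, e) <= delta |e|^2] with [delta = Cst K].  For the additive
  smoother [K = 1/omega], with equality.  For the multiplicative one
  [B = E^* E], where [E] is the error operator of one sweep, so that
  [a((1 - B) w, w) = |w|^2 - |E w|^2] is the sum of the squared sweep
  increments; each [P_j w] is a sum of at most [M] projected increments, whence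
  [K = M^2] ([sum_sqr_proj_le]).

- Smoothing.  If [p] is the spectral measure of [1 - B] at [e], normalized to
  mass one, the approximation bound reads [int 1/l dp <= delta] and must imply
  [int (1 - l)^(2m) dp <= eps_m(delta)^2].  With [n = 2m] it follows by
  integrating against [dp / l] the tangent line inequality
  [l (1 - l)^n <= q(t) + q'(t) (l - t)], [q(l) = l (1 - l)^n], valid on [[0,1]]
  for [0 <= t <= 1/(n+1)].  The choice [t = 1/delta] gives the first branch of
  [eps_m], and [t = 1/(n+1)], where [q' = 0], the second.

No spectral decomposition enters.  With [x = (1 - B)^-1 e] the integrals are
combinations of the moments [d_k = a((1 - B) B^k x, x)], and the tangent line
inequality is a nonnegative combination of the inequalities
[d_(k+2) - 2 s d_(k+1) + s^2 d_k >= 0], [s = 1 - t], each of which says that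
[(1 - B) B^k] is positive semidefinite at [(B - s) x]
([moment_difference_le], [symmetric_moment_difference_le]). *)

Set Implicit Arguments.
Unset Strict Implicit.
Unset Printing Implicit Defensive.

Import Order.TTheory GRing.Theory Num.Theory.
Local Open Scope ring_scope.

(** * A tangent line inequality for moment sequences *)

(** The moment form of [l (1 - l)^n <= q(t) + q'(t) (l - t)] with
[q(l) = l (1 - l)^n] and [t = 1 - s]: if [d k] is the integral of [b^k] against a
positive measure on the half-line [b >= 0], the hypothesis is the positivity of
the integral of [b^k (b - s)^2], and the conclusion, with [l = 1 - b], is the
integrated inequality.  Both sides carry a factor [s], since [q'(t)] involves [s^(n-1)]. *)
Lemma moment_difference_le (R : realFieldType) (d : nat -> R) (s : R) (n : nat) :
  0 <= s <= 1 -> n.+1%:R * (1 - s) <= 1 ->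
  (forall k, 0 <= d k.+2 - 2 * s * d k.+1 + s ^+ 2 * d k) ->
  s * (d n - d n.+1)
    <= s ^+ n * ((1 - n.+1%:R * (1 - s)) * (d 0 - d 1)
                 + n%:R * (1 - s) ^+ 2 * d 0).
Proof.
move=> /andP[s0 sle1] st hd.
(* [w k / s^k] is nondecreasing in [k], and
   [s d_k = s^(k+1) d_0 + sum_(i < k) s^(k-i) w_i] *)
pose w k := d k.+1 - s * d k.
have wS k : s * w k <= w k.+1.
  by rewrite -subr_ge0; move: (hd k); congr (0 <= _); rewrite /w; ring.
have w_ge k : s ^+ k * w 0 <= w k.
  elim: k => [|k IH]; first by rewrite mul1r.
  by apply: le_trans (wS k); rewrite exprS -mulrA ler_wpM2l.
have d_le k : s * d k <= s ^+ k.+1 * d 0 + k%:R * w k.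
  elim: k => [|k IH]; first by rewrite mul0r addr0.
  have -> : s * d k.+1 = s * (s * d k) + s * w k by rewrite /w; ring.
  apply: (@le_trans _ _ (s * (s ^+ k.+1 * d 0 + k%:R * w k) + s * w k)).
    by rewrite lerD2r ler_wpM2l.
  have -> : s * (s ^+ k.+1 * d 0 + k%:R * w k) + s * w k
      = s ^+ k.+2 * d 0 + k.+1%:R * (s * w k).
    by rewrite [s ^+ k.+2]exprS -natr1; ring.
  by rewrite lerD2l ler_wpM2l.
have s1 : 0 <= 1 - n.+1%:R * (1 - s) by rewrite subr_ge0.
have -> : s * (d n - d n.+1) = (1 - s) * (s * d n) - s * w n by rewrite /w; ring.
apply: (@le_trans _ _ ((1 - s) * (s ^+ n.+1 * d 0 + n%:R * w n) - s * w n)).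
  by rewrite lerD2r ler_wpM2l // subr_ge0.
have -> : (1 - s) * (s ^+ n.+1 * d 0 + n%:R * w n) - s * w n
    = (1 - s) * s ^+ n.+1 * d 0 - (1 - n.+1%:R * (1 - s)) * w n.
  by rewrite -natr1; ring.
apply: (@le_trans _ _ ((1 - s) * s ^+ n.+1 * d 0
                       - (1 - n.+1%:R * (1 - s)) * (s ^+ n * w 0))).
  by rewrite lerD2l lerN2 ler_wpM2l.
by rewrite le_eqVlt; apply/orP; left; apply/eqP; rewrite /w exprS -natr1; ring.
Qed.

(** * The rate *)

Section Rate.
Variable R : realType.
Implicit Types (m : nat) (delta : R).

(** In the second branch the squared rate is [delta] times the maximum over
[[0,1]] of [l (1 - l)^(2m)], attained at [1 - l = m / (m + 1/2)]. *)
Lemma smoothing_rate_sqr m delta : 0 <= delta -> (delta - 1) / 2 < m%:R ->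
  smoothing_rate m delta ^+ 2
  = delta * ((m%:R / (m%:R + 1 / 2)) ^+ (2 * m) * (1 - m%:R / (m%:R + 1 / 2))).
Proof.
move=> d0 hm; rewrite /smoothing_rate leNgt hm /=.
have sqr_half (x : R) : 0 <= x -> (x `^ (1 / 2)) ^+ 2 = x.
  by move=> x0; rewrite mul1r powR12_sqrt // sqr_sqrtr.
set x : R := m%:R + 1 / 2.
have x0 : 0 < x by rewrite /x ltr_wpDl // divr_gt0.
rewrite powRD ?(gt_eqF x0) ?implybT // powR_mulrn ?(ltW x0) //.
rewrite !exprMn exprVn exprMn !sqr_half ?divr_ge0 ?(ltW x0) //.
rewrite -!exprM ![(m * 2)%N]mulnC exprVn.
have -> : 1 - m%:R / x = (1 / 2) / x.
  by rewrite /x; field; rewrite -/x; have := lt0r_neq0 x0.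
by rewrite invfM; ring.
Qed.

Lemma smoothing_rate_ge0 m delta : 0 <= smoothing_rate m delta.
Proof.
rewrite /smoothing_rate; case: ifPn => h; last first.
  by rewrite !mulr_ge0 ?powR_ge0 ?exprn_ge0 ?invr_ge0 ?powR_ge0.
have d1 : 1 <= delta by have := ler0n R m; lra.
by rewrite exprn_ge0 // divr_ge0 ?subr_ge0 // (le_trans ler01).
Qed.

Lemma smoothing_rate_le1 m delta : 0 <= delta -> smoothing_rate m delta <= 1.
Proof.
move=> d0; have m0 := ler0n R m.
case: (leP m%:R ((delta - 1) / 2)) => h.
  rewrite /smoothing_rate h.
  have d1 : 1 <= delta by lra.
  have d2 : 0 < delta by lra.
  by rewrite exprn_ile1 ?divr_ge0 ?subr_ge0 // ler_pdivrMr // mul1r gerBl.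
rewrite -(@ler_pXn2r _ 2) ?nnegrE ?smoothing_rate_ge0 // expr1n.
rewrite smoothing_rate_sqr //; set x : R := m%:R + 1 / 2.
have x0 : 0 < x by rewrite /x; lra.
have -> : 1 - m%:R / x = (1 / 2) / x.
  by rewrite /x; field; rewrite -/x; have := lt0r_neq0 x0.
rewrite mulrCA; apply: mulr_ile1.
- by rewrite exprn_ge0 // divr_ge0 ?(ltW x0).
- by rewrite mulr_ge0 // divr_ge0 ?(ltW x0).
- by rewrite exprn_ile1 ?divr_ge0 ?(ltW x0) // ler_pdivrMr // mul1r /x; lra.
- by rewrite mulrA ler_pdivrMr // /x; lra.
Qed.

End Rate.

(** * The smoothing property of symmetric iterations *)

Section Symmetric.
Variables (R : realType) (Vt : vectType R).
Variable a : {dot Vt for (idfun : R -> R)}.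
Implicit Types (x y z : Vt).

Lemma dotC x y : a x y = a y x.
Proof. by rewrite hermC expr0 mul1r. Qed.

Lemma dot_ge0 x : 0 <= a x x.
Proof.
have [->|nz] := eqVneq x 0; first by rewrite linear0l.
exact/ltW/(@neq0_dnorm_gt0 _ _ _ a).
Qed.

Lemma dot_eq0 x : a x x = 0 -> x = 0.
Proof.
move=> h; apply/eqP/negPn/negP => /(@neq0_dnorm_gt0 _ _ _ a).
by rewrite h ltxx.
Qed.

Lemma dot_inj x y : (forall z, a x z = a y z) -> x = y.
Proof.
move=> h; apply/eqP; rewrite -subr_eq0; apply/eqP/dot_eq0.
by rewrite linearBl /= h subrr.
Qed.

Lemma dotZl c x y : a (c *: x) y = c * a x y.
Proof. exact: linearZl_LR. Qed.

Lemma dotZr c x y : a x (c *: y) = c * a x y.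
Proof. by rewrite dotC dotZl dotC. Qed.

Lemma dotDl x y z : a (x + y) z = a x z + a y z.
Proof. exact: linearDl. Qed.

Lemma dotDr x y z : a z (x + y) = a z x + a z y.
Proof. exact: linearDr. Qed.

Lemma dotBl x y z : a (x - y) z = a x z - a y z.
Proof. exact: linearBl. Qed.

Lemma dotBr x y z : a z (x - y) = a z x - a z y.
Proof. exact: linearBr. Qed.

Lemma dotNl x y : a (- x) y = - a x y.
Proof. exact: linearNl. Qed.

Lemma dotNr x y : a x (- y) = - a x y.
Proof. exact: linearNr. Qed.

Lemma dot_suml (I : finType) (P : pred I) (x : I -> Vt) z :
  a (\sum_(i | P i) x i) z = \sum_(i | P i) a (x i) z.
Proof. exact: linear_sumlz. Qed.

Lemma dot_sumr (I : finType) (P : pred I) (x : I -> Vt) z :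
  a z (\sum_(i | P i) x i) = \sum_(i | P i) a z (x i).
Proof. exact: linear_sumr. Qed.

Definition dotE := (dotDl, dotDr, dotNl, dotNr, dotZl, dotZr).

Section Iterates.
Variable B : Vt -> Vt.
Hypothesis B_sym : forall x y, a (B x) y = a x (B y).

(** Linearity is a consequence of symmetry, by nondegeneracy of [a]. *)
Lemma symmetric_linear : linear B.
Proof.
by move=> c x y; apply: dot_inj => z; rewrite B_sym !dotE !B_sym.
Qed.

Lemma iter_symmetric k x y : a (iter k B x) y = a x (iter k B y).
Proof. by elim: k x y => // k IH x y; rewrite iterS B_sym IH -iterSr. Qed.

Lemma iter_subZ k c x y : iter k B (x - c *: y) = iter k B x - c *: iter k B y.
Proof.
by elim: k => //= k ->; rewrite addrC -scaleNr symmetric_linear scaleNr addrC.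
Qed.

Hypothesis B_ge0 : forall x, 0 <= a (B x) x.
Hypothesis B_le1 : forall x, 0 <= a (x - B x) x.

(** With [T = 1 - B], the operators [T B^(2i)] and [T B^(2i+1)] are congruent
through [B^i] to [T] and to [T B = T B T + B T B], which are positive semidefinite. *)
Lemma moment_difference_ge0 k x : 0 <= a (iter k B x) x - a (iter k.+1 B x) x.
Proof.
have split_iter i j : a (iter (i + j) B x) x = a (iter i B x) (iter j B x).
  by rewrite addnC iterD iter_symmetric dotC.
rewrite -[k]odd_double_half -addnn; set i := k./2.
set y := iter i B x.
case: (odd k); rewrite ?add1n ?add0n; last first.
  by rewrite -addSn !split_iter iterS -/y -dotBl.
have -> : (i + i).+2 = (i.+1 + i.+1)%N by rewrite addnS.
rewrite -addSn !split_iter iterS -/y.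
have := addr_ge0 (B_ge0 (y - B y)) (B_le1 (B y)).
have BB : B (y - B y) = B y - B (B y).
  by have := iter_subZ 1 1 y (B y); rewrite !scale1r.
rewrite BB !dotE (B_sym (B y) y).
by congr (0 <= _); ring.
Qed.

(** The tangent line inequality at the operator level, for the moments
[a ((1 - B) B^k x) x]: their differences are the quantities [a (B^k e) e], and the
quadratic condition on them is [moment_difference_ge0] at [B x - s x]. *)
Lemma symmetric_moment_difference_le n s x : let e := x - B x in
  0 <= s <= 1 -> n.+1%:R * (1 - s) <= 1 ->
  s * a (iter n B e) e
    <= s ^+ n * ((1 - n.+1%:R * (1 - s)) * a e e + n%:R * (1 - s) ^+ 2 * a e x).
Proof.
move=> e s01 hs.
pose d k := a (iter k B x) x - a (iter k.+1 B x) x.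
have iterB k : iter k B e = iter k B x - iter k.+1 B x.
  by have := iter_subZ k 1 x (B x); rewrite !scale1r -iterSr.
have dE k : a (iter k B e) e = d k - d k.+1.
  by rewrite iterB /e /d !dotE -!B_sym /=; ring.
have -> : a e x = d 0 by rewrite /e dotBl.
rewrite dE -[e in a e e]/(iter 0 B e) dE.
apply: moment_difference_le => // k.
have := moment_difference_ge0 k (B x - s *: x).
rewrite !iter_subZ -!iterSr !dotE /d -!B_sym /=.
by congr (0 <= _); ring.
Qed.

(** Here [x] stands for [(1 - B)^-1 e].  The squared norm of [B^m e] is
[a (B^(2m) e) e], to which the operator inequality applies; [delta] then replaces
[a e x], and only the contact point [s] remains to be chosen. *)
Lemma smoothing_property m delta e x : (1 <= m)%N -> 0 <= delta ->
  e = x - B x -> a e x <= delta * a e e ->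
  energy_norm a (iter m B e) <= smoothing_rate m delta * energy_norm a e.
Proof.
move=> m1 d0 ex hd.
rewrite -(@ler_pXn2r _ 2) ?nnegrE ?mulr_ge0 ?smoothing_rate_ge0 ?sqrtr_ge0 //.
rewrite exprMn /energy_norm !sqr_sqrtr ?dot_ge0 // -iter_symmetric -iterD addnn.
set n := m.*2; set t0 := a e e.
have t00 : 0 <= t0 := dot_ge0 e.
have mR : 1 <= m%:R :> R by rewrite ler1n.
have nR : n%:R = 2 * m%:R :> R by rewrite /n -muln2 natrM mulrC.
have bound s : 0 < s <= 1 -> n.+1%:R * (1 - s) <= 1 ->
    s * a (iter n B e) e <= s ^+ n *
     ((1 - n.+1%:R * (1 - s) + n%:R * (1 - s) ^+ 2 * delta) * t0).
  move=> /andP[s0 s1] hs; have := symmetric_moment_difference_le x _ hs.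
  rewrite -ex (ltW s0) s1 => /(_ isT) h; apply: le_trans h _.
  rewrite ler_wpM2l ?exprn_ge0 ?(ltW s0) // [leRHS]mulrDl lerD2l -[leRHS]mulrA.
  by rewrite ler_wpM2l // mulr_ge0 ?exprn_ge0 // subr_ge0.
have [h|h] := leP m%:R ((delta - 1) / 2).
  have d1 : 0 < delta by lra.
  (* contact point at 1 - s = 1 / delta *)
  pose s := (delta - 1) / delta.
  have st : 1 - s = delta^-1 by rewrite /s; field; rewrite gt_eqF.
  have s0 : 0 < s by rewrite /s divr_gt0 //; lra.
  have s1 : s <= 1 by rewrite -subr_ge0 st invr_ge0.
  rewrite /smoothing_rate h -/s -exprM muln2 -/n.
  rewrite -(ler_pM2l s0); apply: le_trans (bound s _ _) _; first by rewrite s0.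
    by rewrite st ler_pdivrMr // mul1r -natr1 nR; lra.
  rewrite st le_eqVlt; apply/orP; left; apply/eqP.
  by rewrite -natr1 /s; field; rewrite gt_eqF.
(* contact point at 1 - s = 1 / (2m + 1), where the tangent is horizontal *)
pose s : R := m%:R / (m%:R + 1 / 2).
have q0 : 0 < m%:R + 1 / 2 :> R by lra.
have st : n.+1%:R * (1 - s) = 1.
  by rewrite -natr1 nR /s; field; rewrite gt_eqF //; lra.
have ns : n%:R * (1 - s) = s.
  by rewrite nR /s; field; rewrite gt_eqF //; lra.
have s0 : 0 < s by rewrite divr_gt0 //; lra.
have s1 : s <= 1 by rewrite ler_pdivrMr // mul1r; lra.
rewrite smoothing_rate_sqr // -/s mul2n -/n.
rewrite -(ler_pM2l s0); apply: le_trans (bound s _ _) _; first by rewrite s0.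
  by rewrite st.
rewrite st subrr add0r expr2 [n%:R * _]mulrA ns.
by rewrite le_eqVlt; apply/orP; left; apply/eqP; ring.
Qed.

End Iterates.
End Symmetric.

(** * Energy projections *)

Section SubspaceCorrection.
Variables (R : realType) (Vt : vectType R).
Variable a : {dot Vt for (idfun : R -> R)}.
Implicit Types (x y z v w : Vt) (U : {vspace Vt}).

Lemma energy_projP U v : energy_proj a U v \in U.
Proof. by have [] := subsolveP a U (energy_op a v). Qed.

Lemma energy_projE U v w : w \in U -> a (energy_proj a U v) w = a v w.
Proof.
move=> wU; have [_ h] := subsolveP a U (energy_op a v).
by rewrite /energy_proj h // energy_opE.
Qed.

Lemma energy_proj_unique U v w :
  w \in U -> {in U, forall z, a w z = a v z} -> w = energy_proj a U v.
Proof.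
by move=> wU h; apply: subsolve_unique => // z zU; rewrite h // energy_opE.
Qed.

Lemma energy_proj_sym U x y : a (energy_proj a U x) y = a x (energy_proj a U y).
Proof.
rewrite -(energy_projE x (energy_projP U y)) dotC.
by rewrite -(energy_projE y (energy_projP U x)) dotC.
Qed.

Lemma dot_energy_proj U v :
  a (energy_proj a U v) v = a (energy_proj a U v) (energy_proj a U v).
Proof. by rewrite (energy_projE v (energy_projP U v)) dotC. Qed.

Lemma energy_proj_sub U x y :
  energy_proj a U (x - y) = energy_proj a U x - energy_proj a U y.
Proof.
apply/esym/energy_proj_unique; first by rewrite memvB ?energy_projP.
by move=> z zU; rewrite !dotBl !energy_projE.
Qed.

Lemma energy_proj_add U x y :
  energy_proj a U (x + y) = energy_proj a U x + energy_proj a U y.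
Proof.
apply/esym/energy_proj_unique; first by rewrite memvD ?energy_projP.
by move=> z zU; rewrite !dotDl !energy_projE.
Qed.

Lemma energy_proj_sum U (I : finType) (A : pred I) (y : I -> Vt) :
  energy_proj a U (\sum_(i | A i) y i) = \sum_(i | A i) energy_proj a U (y i).
Proof.
apply/esym/energy_proj_unique; first exact: memv_suml (fun i _ => energy_projP _ _).
by move=> z zU; rewrite !dot_suml; apply: eq_bigr => i _; exact: energy_projE.
Qed.

Lemma energy_proj_le U x :
  a (energy_proj a U x) (energy_proj a U x) <= a x x.
Proof.
have := dot_ge0 a (x - energy_proj a U x); rewrite !dotBl !dotBr.
by rewrite (dotC _ x (energy_proj a U x)) dot_energy_proj; lra.
Qed.

Lemma energy_proj_id U x : x \in U -> energy_proj a U x = x.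
Proof. by move=> xU; apply/esym/energy_proj_unique. Qed.

Lemma energy_op_sub v w : energy_op a v - energy_op a w = energy_op a (v - w).
Proof. by apply/lfunP => x; rewrite !lfunE /= !lfunE /= dotBl !energy_opE. Qed.

(** * Convergence of subspace corrections *)

Variables (J : nat) (W : 'I_J -> {vspace Vt}).
Hypothesis hW : (\sum_(j < J) W j)%VS = fullv.
Local Notation P j := (energy_proj a (W j)).

Lemma energy_proj_eq0 v : (forall j, P j v = 0) -> v = 0.
Proof.
move=> h; apply: (@dot_eq0 _ _ a).
have : v \in (\sum_(j < J) W j)%VS by rewrite hW memvf.
case/memv_sumP => w hw vE; rewrite {2}vE dot_sumr big1 // => j _.
by rewrite -(energy_projE _ (hw j isT)) h linear0l.
Qed.

Definition stable_splitting (Cst : R) (e : Vt) : Prop :=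
  exists w : 'I_J -> Vt,
    [/\ forall j, w j \in W j, e = \sum_(j < J) w j
      & \sum_(j < J) energy_norm a (w j) ^+ 2 <= Cst * energy_norm a e ^+ 2].

(** Cauchy-Schwarz over the family of subspaces: if [e = sum_j w_j] then
[a e x = sum_j a w_j (P_j x)].  With [e = (1 - B) x] this bounds
[a((1 - B)^-1 e, e)]. *)
Lemma stable_splitting_dot_le Cst K e x : 0 <= K -> stable_splitting Cst e ->
  \sum_(j < J) energy_norm a (P j x) ^+ 2 <= K * a e x ->
  a e x <= Cst * K * a e e.
Proof.
move=> K0 [w [hw ew hC]].
have sqrE v : energy_norm a v ^+ 2 = a v v by rewrite sqr_sqrtr ?dot_ge0.
have exE : a e x = \sum_j a (w j) (P j x).
  rewrite ew dot_suml; apply: eq_bigr => j _.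
  by rewrite [RHS]dotC energy_projE // dotC.
have : 0 <= \sum_j a (K *: w j - P j x) (K *: w j - P j x).
  by apply: sumr_ge0 => j _; exact: dot_ge0.
have -> : \sum_j a (K *: w j - P j x) (K *: w j - P j x)
   = K ^+ 2 * (\sum_j a (w j) (w j)) - 2 * K * a e x + \sum_j a (P j x) (P j x).
  rewrite exE !mulr_sumr -sumrB -big_split /=; apply: eq_bigr => j _.
  by rewrite !dotE (dotC _ (w j)); ring.
rewrite (eq_bigr _ (fun j _ => sqrE _)).
move: hC; rewrite sqrE (eq_bigr _ (fun j _ => sqrE _)).
set s1 := \sum_j _; set s2 := \sum_j _ => h1 h3 h2.
case: (ltrgtP K 0) => [|Kgt|Kz]; first by rewrite ltNge K0.
  by rewrite -(ler_pM2l Kgt); nra.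
(* K = 0 forces every projection of x to vanish *)
have s20 : s2 <= 0 by move: h2; rewrite Kz mul0r.
have x0 : x = 0.
  apply: energy_proj_eq0 => j; apply: (@dot_eq0 _ _ a).
  apply/le_anti; rewrite dot_ge0 andbT; apply: le_trans s20.
  by rewrite /s2 (bigD1 j) //= lerDl sumr_ge0 // => i _; exact: dot_ge0.
by rewrite x0 linear0r Kz mulr0 mul0r.
Qed.

(** The contraction estimate for an abstract subspace correction method with
error operator [B].  The lower bound on [1 - B] makes it definite, hence
invertible, because the subspaces span. *)
Lemma subspace_correction_rate (B : Vt -> Vt) (Cst K : R) m e :
  (forall x y, a (B x) y = a x (B y)) ->
  (forall x, 0 <= a (B x) x) ->
  (1 <= m)%N -> 0 < Cst -> 0 <= K ->
  (forall w, \sum_(j < J) energy_norm a (P j w) ^+ 2 <= K * a (w - B w) w) ->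
  stable_splitting Cst e ->
  energy_norm a (iter m B e) <= smoothing_rate m (Cst * K) * energy_norm a e.
Proof.
move=> B_sym B_ge0 m1 Cst0 K0 hK hst.
have T_gt0 w : w != 0 -> 0 < a (w - B w) w.
  move=> nz; rewrite ltNge; apply: contra nz => le0; apply/eqP.
  apply: energy_proj_eq0 => j; apply: (@dot_eq0 _ _ a).
  apply/le_anti; rewrite dot_ge0 andbT.
  apply: le_trans (le_trans (hK w) (mulr_ge0_le0 K0 le0)).
  rewrite (bigD1 j) //= sqr_sqrtr ?dot_ge0 // lerDl.
  by rewrite sumr_ge0 // => i _; exact: sqr_ge0.
have T_ge0 w : 0 <= a (w - B w) w.
  by have [->|/T_gt0/ltW//] := eqVneq w 0; rewrite linear0r.
have Blin : linear B by exact: (symmetric_linear B_sym).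
have Tlin : linear ((fun w => w - B w) : Vt -> Vt).
  by move=> c x y /=; rewrite Blin opprD addrACA scalerBr.
pose Tm := GRing.isLinear.Build _ _ _ _ _ Tlin.
pose T' : {linear Vt -> Vt} := HB.pack (fun w : Vt => w - B w) Tm.
pose T : 'End(Vt) := linfun T'.
have TE w : T w = w - B w by rewrite /T lfunE.
have Tker : lker T == 0%VS.
  apply/lker0P => x y; rewrite !TE => Txy; apply/eqP; rewrite -subr_eq0.
  apply/negPn/negP => /T_gt0.
  have -> : B (x - y) = B x - B y.
    by have := iter_subZ B_sym 1 1 x y; rewrite !scale1r.
  have -> : x - y - (B x - B y) = (x - B x) - (y - B y).
    by rewrite !opprD addrACA.
  by rewrite Txy subrr linear0l ltxx.
pose x := (T^-1)%VF e.
have ex : e = x - B x by rewrite -TE /x lker0_lfunVK.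
have d0 : 0 <= Cst * K by rewrite mulr_ge0 // ltW.
have hx : a e x <= Cst * K * a e e.
  by apply: stable_splitting_dot_le => //; have := hK x; rewrite -ex.
exact: (smoothing_property B_sym B_ge0 T_ge0 m1 d0 ex hx).
Qed.

(** * The additive smoother *)

Definition additive_error (omega : R) v : Vt := v - omega *: \sum_(j < J) P j v.

Lemma additive_errorE omega v :
  omega *: S_add a W (energy_op a v) = v - additive_error omega v.
Proof. by rewrite /additive_error subKr. Qed.

Lemma additive_error_form omega w :
  a (w - additive_error omega w) w
  = omega * \sum_(j < J) energy_norm a (P j w) ^+ 2.
Proof.
rewrite /additive_error subKr dotZl dot_suml; congr (_ * _).
by apply: eq_bigr => j _; rewrite sqr_sqrtr ?dot_ge0 // dot_energy_proj.
Qed.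

Lemma additive_error_sym omega x y :
  a (additive_error omega x) y = a x (additive_error omega y).
Proof.
rewrite /additive_error !dotBl !dotBr dotZl dotZr dot_suml dot_sumr.
by congr (_ - _ * _); apply: eq_bigr => j _; rewrite energy_proj_sym.
Qed.

(** With [T = omega sum_j P_j], the bound on sums gives [|T x|^2 <= a (T x) x], so
that [0 <= |x - T x|^2 <= a x x - a (T x) x]. *)
Lemma additive_error_ge0 Creg omega : 0 < omega -> omega * Creg <= 1 ->
  (forall (v : Vt) (w : 'I_J -> Vt),
    (forall j, w j \in W j) -> v = \sum_(j < J) w j ->
    energy_norm a v ^+ 2 <= Creg * \sum_(j < J) energy_norm a (w j) ^+ 2) ->
  forall x, 0 <= a (additive_error omega x) x.
Proof.
move=> o0 oC hreg x; set b := additive_error omega x.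
set s := \sum_(j < J) energy_norm a (P j x) ^+ 2.
have s0 : 0 <= s by apply: sumr_ge0 => j _; exact: sqr_ge0.
have hT : a (x - b) x = omega * s by exact: additive_error_form.
pose G := \sum_(j < J) P j x.
have hG : a G G <= Creg * s.
  have := hreg G (fun j => P j x) (fun j => energy_projP _ _) erefl.
  by rewrite sqr_sqrtr ?dot_ge0.
have hTT : a (x - b) (x - b) <= omega * s.
  have -> : x - b = omega *: G by rewrite /b /additive_error subKr.
  rewrite dotZl dotZr ler_wpM2l ?(ltW o0) //.
  apply: (@le_trans _ _ (omega * (Creg * s))); first by rewrite ler_wpM2l // ltW.
  by rewrite mulrA ler_piMl.
have := dot_ge0 a b; move: hTT; rewrite -hT; clearbody b.
by rewrite !dotBl !dotBr (dotC _ x b); lra.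
Qed.

(** * The multiplicative smoother *)

(** The product of the [1 - P j] for [j] in [s], the head of [s] acting first. *)
Definition sweep_error (s : seq 'I_J) v : Vt :=
  foldl (fun w j => w - P j w) v s.

Definition symmetric_sweep_error v : Vt :=
  sweep_error (rev (enum 'I_J)) (sweep_error (enum 'I_J) v).

Lemma mult_sweepE s v :
  mult_sweep a W s (energy_op a v) = v - sweep_error s v.
Proof.
rewrite /mult_sweep /sweep_error.
elim/last_ind: s => [|s j IH]; first by rewrite subrr.
rewrite !foldl_rcons IH energy_op_sub.
set w := foldl _ _ _.
by rewrite -/(energy_proj a (W j) _) !subKr opprB addrA addrAC.
Qed.

Lemma sweep_error_sub s x y :
  sweep_error s (x - y) = sweep_error s x - sweep_error s y.
Proof.
elim: s x y => //= j s IH x y.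
by rewrite -IH energy_proj_sub !opprD addrACA.
Qed.

Lemma sweep_error_rcons s j v :
  sweep_error (rcons s j) v = sweep_error s v - P j (sweep_error s v).
Proof. exact: foldl_rcons. Qed.

Lemma sweep_error_adjoint s x y :
  a (sweep_error s x) y = a x (sweep_error (rev s) y).
Proof.
elim: s x => //= j s IH x.
rewrite rev_cons sweep_error_rcons IH.
by rewrite dotBl dotBr energy_proj_sym.
Qed.

(** If the sweeps have error operators [E] and [E^*], then
[(1 - E) + (1 - E^* ) - (1 - E^* ) (1 - E) = 1 - E^* E]. *)
Lemma S_mult_symE v :
  S_mult_sym a W (energy_op a v) = v - symmetric_sweep_error v.
Proof.
rewrite /symmetric_sweep_error /S_mult_sym /S_mult /S_mult_t.
rewrite !mult_sweepE sweep_error_sub.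
set x := sweep_error _ v; set y := sweep_error (rev _) v.
set z := sweep_error _ x.
by rewrite opprB addrC addrA subrK addrC addrA subrK.
Qed.

(** The relation counted by [max_interactions]. *)
Definition interacts (i j : 'I_J) : bool :=
  `[< (energy_proj a (W i) @` [set v | v \in W j] <> [set 0%R])%classic >].

Lemma interactsN i j v : ~~ interacts i j -> v \in W j -> P i v = 0.
Proof.
move=> /asboolPn/contrapT h vj.
have : (energy_proj a (W i) @` [set v | v \in W j])%classic (P i v) by exists v.
by rewrite h.
Qed.

(** [P i] vanishes on [W j] exactly when [W i] and [W j] are [a]-orthogonal. *)
Lemma interacts_sym i j : interacts i j = interacts j i.
Proof.
suff h k l : ~~ interacts k l -> ~~ interacts l k.
  by apply/idP/idP; apply: contraTT; exact: h.
move=> hkl; apply/asboolPn => ne; apply: ne.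
rewrite predeqE => x /=; split=> [[v vk <-]|->].
  apply: (@dot_eq0 _ _ a); rewrite -dot_energy_proj -(energy_projE _ vk).
  by rewrite (interactsN hkl) ?energy_projP // linear0l.
exists 0; first exact: mem0v.
by rewrite -[X in energy_proj _ _ X](subrr 0) energy_proj_sub subrr.
Qed.

Lemma max_interactions_ge (j : 'I_J) :
  (#|[pred i | interacts i j]| <= max_interactions a W)%N.
Proof. exact: (leq_bigmax_cond (F := fun j => #|[pred i | interacts i j]|)). Qed.

Lemma dot_sum_le (I : finType) (A : pred I) (y : I -> Vt) :
  a (\sum_(i | A i) y i) (\sum_(i | A i) y i)
    <= #|A|%:R * \sum_(i | A i) a (y i) (y i).
Proof.
rewrite dot_suml; under eq_bigr do rewrite dot_sumr.
rewrite -(@ler_pM2l _ 2) //.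
have -> : 2 * (#|A|%:R * \sum_(i | A i) a (y i) (y i))
   = \sum_(i | A i) \sum_(k | A k) (a (y i) (y i) + a (y k) (y k)).
  set t := \sum_(i | A i) a (y i) (y i).
  transitivity (\sum_(i | A i) (#|A|%:R * a (y i) (y i) + t)).
    by rewrite big_split /= -mulr_sumr sumr_const -/t -[t *+ _]mulr_natl; lra.
  by apply: eq_bigr => i _; rewrite big_split /= sumr_const mulr_natl.
rewrite mulr_sumr; apply: ler_sum => i _.
rewrite mulr_sumr; apply: ler_sum => k _.
by have := dot_ge0 a (y i - y k); rewrite !dotBl !dotBr (dotC _ (y k)); lra.
Qed.

(** Let [g k] be the error after [k] corrections of a sweep started from [w], and
[x j = P j (g j)] the increments.  By Pythagoras, [|w|^2 - |E w|^2] is the sum of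
the [|x j|^2].  Since [w = g j + sum_(i < j) x i], the projection [P j w] is the
sum over [i <= j] of the [P j (x i)], which vanish unless [i] and [j] interact.  One
factor [M] counts the terms of that sum, and the other the indices [j] in which a
given [x i] appears. *)
Lemma sum_sqr_proj_le w :
  \sum_(j < J) energy_norm a (P j w) ^+ 2
    <= (max_interactions a W)%:R ^+ 2
       * (a w w - a (sweep_error (enum 'I_J) w) (sweep_error (enum 'I_J) w)).
Proof.
set E := sweep_error (enum 'I_J); set M := max_interactions a W.
pose g k := sweep_error (take k (enum 'I_J)) w.
pose x (j : 'I_J) := P j (g j).
have gS (j : 'I_J) : g j.+1 = g j - x j.
  rewrite /g (take_nth j) ?size_enum_ord // nth_ord_enum.
  by rewrite sweep_error_rcons.
have lt_neq k (kJ : (k < J)%N) (i : 'I_J) :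
    (i < k.+1)%N && (i != Ordinal kJ) = (i < k)%N.
  by rewrite ltnS -(inj_eq val_inj) /= andbC ltn_neqAle.
have gE k : (k <= J)%N -> g k = w - \sum_(i < J | (i < k)%N) x i.
  elim: k => [|k IH] kJ.
    by rewrite /g take0 /= big_pred0 ?subr0.
  have := gS (Ordinal kJ); rewrite /= => ->; rewrite IH ?(ltnW kJ) //.
  rewrite [in RHS](bigD1 (Ordinal kJ)) //= (eq_bigl _ _ (lt_neq k kJ)).
  by rewrite opprD addrA addrAC.
have gN k : (k <= J)%N ->
    a w w - a (g k) (g k) = \sum_(i < J | (i < k)%N) a (x i) (x i).
  elim: k => [|k IH] kJ.
    by rewrite /g take0 /= big_pred0 ?subrr.
  rewrite [RHS](bigD1 (Ordinal kJ)) //=.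
  rewrite (eq_bigl _ _ (lt_neq k kJ)) -IH ?(ltnW kJ) //.
  have := gS (Ordinal kJ); rewrite /= => ->.
  have := dot_energy_proj (W (Ordinal kJ)) (g k); rewrite -/(x (Ordinal kJ)).
  by rewrite !dotBl !dotBr (dotC _ (g k) (x _)) => ->; ring.
have -> : a w w - a (E w) (E w) = \sum_(i < J) a (x i) (x i).
  have := gN J (leqnn J); rewrite /g take_oversize ?size_enum_ord // => ->.
  by apply: eq_bigl => i; rewrite ltn_ord.
pose A (j : 'I_J) := [pred i | interacts i j].
have Pw j : a (P j w) (P j w) <= M%:R * \sum_(i | A j i) a (x i) (x i).
  have -> : P j w = \sum_(i | A j i) (if (i <= j)%N then P j (x i) else 0).
    have -> : P j w = \sum_(i < J | (i <= j)%N) P j (x i).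
      have -> : w = g j + \sum_(i < J | (i < j)%N) x i.
        by rewrite gE ?(ltnW (ltn_ord j)) // subrK.
      have xW i : P i (x i) = x i by rewrite energy_proj_id ?energy_projP.
      rewrite [RHS](bigD1 j) //= xW energy_proj_add energy_proj_sum.
      congr (_ + _); apply: eq_bigl => i.
      by rewrite -(inj_eq val_inj) /= andbC ltn_neqAle.
    rewrite big_mkcond [RHS]big_mkcond /=; apply: eq_bigr => i _.
    case: ifP => // ij; case: ifPn => // nij.
    by rewrite (interactsN _ (energy_projP _ _)) // interacts_sym.
  apply: le_trans (dot_sum_le _ _) _; apply: ler_pM => //.
  - by apply: sumr_ge0 => i _; exact: dot_ge0.
  - by rewrite ler_nat; exact: max_interactions_ge.
  - apply: ler_sum => i _; case: ifP => _; first exact: energy_proj_le.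
    by rewrite linear0l dot_ge0.
apply: (@le_trans _ _ (\sum_j M%:R * \sum_(i | A j i) a (x i) (x i))).
  by apply: ler_sum => j _; rewrite sqr_sqrtr ?dot_ge0 // Pw.
rewrite -mulr_sumr expr2 -mulrA ler_wpM2l //.
rewrite (exchange_big_dep predT) // mulr_sumr; apply: ler_sum => i _.
rewrite sumr_const -[leLHS]mulr_natl ler_wpM2r ?dot_ge0 // ler_nat.
apply: leq_trans (max_interactions_ge i); apply: eq_leq; apply: eq_card => j.
by rewrite !inE interacts_sym.
Qed.

Lemma symmetric_sweep_error_sym x y :
  a (symmetric_sweep_error x) y = a x (symmetric_sweep_error y).
Proof.
by rewrite /symmetric_sweep_error sweep_error_adjoint revK -sweep_error_adjoint.
Qed.

Lemma symmetric_sweep_error_form x :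
  a (symmetric_sweep_error x) x
  = a (sweep_error (enum 'I_J) x) (sweep_error (enum 'I_J) x).
Proof. by rewrite /symmetric_sweep_error sweep_error_adjoint revK. Qed.

End SubspaceCorrection.

(** * The error of the smoothed solution *)

Section Smoothing.
Variables (R : realType) (Vt : vectType R).
Variable a : {dot Vt for (idfun : R -> R)}.

Lemma smoothing_iterE (S : 'Hom(Vt, R^o) -> Vt) (B : Vt -> Vt) ut u0 m :
  (forall v, S (energy_op a v) = v - B v) ->
  smoothing_iter a S (energy_op a ut) m u0 = ut - iter m B (ut - u0).
Proof.
move=> SE; elim: m => [|m IH]; first by rewrite /= subKr.
rewrite /smoothing_iter iterS -/(smoothing_iter _ _ _ _ _) IH /=.
by rewrite energy_op_sub subKr SE addrA subrK.
Qed.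

(** Two triangle inequalities through [ut]; [eps <= 1] absorbs the second
occurrence of [N (u - iota ut)]. *)
Lemma error_le_of_contraction (E : lmodType R) (iota : {linear Vt -> E})
    (u : E) (N : E -> R) (ut uh r : Vt) (eps : R) :
  seminorm_on
    [set x : E | exists v : Vt, exists c : R, x = iota v + c *: u]%classic N ->
  (forall v, N (iota v) = energy_norm a v) ->
  0 <= eps <= 1 -> energy_norm a r <= eps * energy_norm a (ut - uh) ->
  N (u - iota (ut - r)) <= 2 * N (u - iota ut) + eps * N (u - iota uh).
Proof.
move=> [Nadd NZ] Niota /andP[eps0 eps1] hr.
pose D := [set x : E | exists v : Vt, exists c : R, x = iota v + c *: u]%classic.
have Diota v : D (iota v) by exists v, 0; rewrite scale0r addr0.
have Du v : D (u - iota v).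
  by exists (- v), 1; rewrite raddfN scale1r addrC.
have DN v : D (- (u - iota v)).
  by exists v, (-1); rewrite scaleN1r opprB.
have NN v : N (- (u - iota v)) = N (u - iota v).
  by rewrite -scaleN1r NZ ?normrN1 ?mul1r //; exact: Du.
have N0 : N 0 = 0.
  by have := NZ 0 _ (Diota 0); rewrite scale0r normr0 mul0r.
have N_ge0 v : 0 <= N (u - iota v).
  by have := Nadd _ _ (Du v) (DN v); rewrite subrr N0 NN; lra.
have h1 : N (u - iota (ut - r)) <= N (u - iota ut) + energy_norm a r.
  rewrite -Niota raddfB.
  have -> : u - (iota ut - iota r) = (u - iota ut) + iota r.
    by rewrite opprB addrCA addrC.
  exact: (Nadd _ _ (Du _) (Diota _)).
have h2 : energy_norm a (ut - uh) <= N (u - iota uh) + N (u - iota ut).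
  rewrite -Niota -(NN ut) raddfB.
  have -> : iota ut - iota uh = (u - iota uh) + - (u - iota ut).
    by rewrite opprB [RHS]addrC subrKA.
  exact: (Nadd _ _ (Du _) (DN _)).
apply: le_trans h1 _; have := ler_wpM2l eps0 h2.
have : eps * N (u - iota ut) <= N (u - iota ut) by rewrite ler_piMl.
by rewrite mulrDr; lra.
Qed.

End Smoothing.

Theorem corollary2p4 (R : realType) (Vt : vectType R)
  (a : {dot Vt for (idfun : R -> R)}) (V : {vspace Vt})
  (f : 'Hom(subvs_of V, R^o)) (ft : 'Hom(Vt, R^o))
  (hf : forall v : subvs_of V, ft (vsval v) = f v)
  (uh : Vt) (uhV : uh \in V)
  (huh : forall v : subvs_of V, a uh (vsval v) = f v)
  (ut : Vt) (hut : forall v : Vt, a ut v = ft v)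
  (* exact solution, in a space E containing Vt, and extended seminorm *)
  (E : lmodType R) (iota : {linear Vt -> E}) (iota_inj : injective iota)
  (u : E) (N : E -> R)
  (hN : seminorm_on
          [set x : E | exists v : Vt, exists c : R, x = iota v + c *: u]%classic N)
  (N_energy : forall v : Vt, N (iota v) = energy_norm a v)
  (J : nat) (W : 'I_J -> {vspace Vt})
  (hW : (\sum_(j < J) W j)%VS = fullv)
  (Cst Creg : R) (Cst_gt0 : 0 < Cst) (Creg_gt0 : 0 < Creg)
  (A1 : forall v : Vt, v \in orthov a V ->
    exists w : 'I_J -> Vt,
      [/\ forall j, w j \in W j, v = \sum_(j < J) w j
        & \sum_(j < J) energy_norm a (w j) ^+ 2 <= Cst * energy_norm a v ^+ 2])
  (A2 : forall (v : Vt) (w : 'I_J -> Vt),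
    (forall j, w j \in W j) -> v = \sum_(j < J) w j ->
    energy_norm a v ^+ 2 <= Creg * \sum_(j < J) energy_norm a (w j) ^+ 2)
  (omega : R) (omega_gt0 : 0 < omega) (omega_le : omega <= Creg^-1)
  (m : nat) (m_ge1 : (1 <= m)%N) :
  let Rm (S : 'Hom(Vt, R^o) -> Vt) := iota (smoothing_iter a S ft m uh) in
  let M := max_interactions a W in
  N (u - Rm (fun r => omega *: S_add a W r))
    <= 2 * N (u - iota ut) + smoothing_rate m (Cst / omega) * N (u - iota uh)
  /\
  N (u - Rm (S_mult_sym a W))
    <= 2 * N (u - iota ut)
       + smoothing_rate m (Cst * M%:R ^+ 2) * N (u - iota uh).
Proof.
move=> Rm M.
have ftE : ft = energy_op a ut by apply/lfunP => v; rewrite energy_opE hut.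
pose e := ut - uh.
have eV : e \in orthov a V.
  apply/mem_orthovP => v vV.
  suff : a e v = 0 by [].
  by rewrite /e dotBl hut -[v]/(vsval (Subvs vV)) huh hf subrr.
have rate01 (delta : R) : 0 <= delta -> 0 <= smoothing_rate m delta <= 1.
  by move=> d0; rewrite smoothing_rate_ge0 smoothing_rate_le1.
have bound S B delta : (forall v, S (energy_op a v) = v - B v) -> 0 <= delta ->
    energy_norm a (iter m B e) <= smoothing_rate m delta * energy_norm a e ->
    N (u - Rm S)
      <= 2 * N (u - iota ut) + smoothing_rate m delta * N (u - iota uh).
  move=> SE d0 hB; rewrite /Rm ftE (smoothing_iterE _ _ _ SE).
  exact: (error_le_of_contraction hN N_energy (rate01 _ d0) hB).
split.
- apply: (bound _ (additive_error a W omega)).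
  + by move=> v; exact: additive_errorE.
  + by rewrite divr_ge0 ?ltW.
  apply: (subspace_correction_rate hW) => //; last exact: A1.
  + exact: additive_error_sym.
  + apply: (additive_error_ge0 omega_gt0 _ A2).
    by rewrite -ler_pdivlMr // div1r.
  + by rewrite invr_ge0 ltW.
  + by move=> w; rewrite additive_error_form mulKf ?gt_eqF.
- apply: (bound _ (symmetric_sweep_error a W)).
  + by move=> v; exact: S_mult_symE.
  + by rewrite mulr_ge0 ?exprn_ge0 // ltW.
  apply: (subspace_correction_rate hW) => //; last exact: A1.
  + exact: symmetric_sweep_error_sym.
  + by move=> x; rewrite symmetric_sweep_error_form dot_ge0.
  + move=> w; rewrite dotBl symmetric_sweep_error_form.
    exact: sum_sqr_proj_le.
Qed.
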